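(* Let $\varphi\colon\mathbb{R}^n\to\mathbb{R}$ be a $\mathcal{C}^2$-smooth function, and consider the globalized Newton algorithm described in the context, with parameters $x^0\in\mathbb{R}^n$, $\sigma\in(0,1/2)$, $\beta\in(0,1)$, $\zeta>0$. Then the algorithm either terminates after finitely many iterations or generates sequences $\{x^k\}$ and $\{\hat{x}^k\}$ such that the sequences of function values $\{\varphi(x^k)\}$ and $\{\varphi(\hat{x}^k)\}$ are monotonically decreasing. Moreover, the following assertions hold: (i) If $\inf_k \varphi(x^k)>-\infty$, then $\sum_{k=1}^\infty \tau_k\|d^k\|^2<\infty$. (ii) If $\varphi$ is $\mathcal{C}^{1,1}_L$ for some $L>0$, then the sequence $\{\tau_k\}$ is bounded away from $0$. Consequently, the sequences $\{\|d^k\|\}$ and $\{\|\nabla\varphi(\hat{x}^k)\|\}$ converge to $0$ as $k\to\infty$. (iii) Suppose that $\{\hat{x}^k\}$ satisfies the following condition: $\|\hat{x}^k-x^k\|\to 0$ as $k\to\infty$, $k\in J$, whenever $J\subset\mathbb{N}$ and the subsequence $\{x^k\}_{k\in J}$ is convergent. Then every accumulation point of $\{x^k\}$ is a stationary point of $\varphi$. If in addition $\bar{x}$ is an isolated accumulation point of $\{x^k\}$, then $\{x^k\}$ converges to $\bar{x}$ as $k\to\infty$.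
   Context: $\mathbb{R}^n$ carries the Euclidean norm and standard inner product; $\mathbb{N}=\{0,1,2,\dots\}$. A function $\varphi$ is $\mathcal{C}^{1,1}_L$ if it is differentiable and $\nabla\varphi$ is Lipschitz continuous on $\mathbb{R}^n$ with modulus $L$. A point $\bar x$ is stationary if $\nabla\varphi(\bar x)=0$. For a symmetric matrix $A$, $\lambda_{\min}(A)$ denotes its smallest eigenvalue. Assertions (i)-(iii) concern the case in which the algorithm does not terminate and generates infinite sequences. Globalized Newton algorithm. Input: $x^0\in\mathbb{R}^n$, $\sigma\in(0,1/2)$, $\beta\in(0,1)$, $\zeta>0$. For $k=0,1,2,\dots$: Step 1: Choose $\hat{x}^k\in\mathbb{R}^n$ satisfying $\varphi(\hat{x}^k)\le\varphi(x^k)$. If $\nabla\varphi(\hat{x}^k)=0$, stop. Otherwise go to Step 2. Step 2: Set $d^k=-\nabla^2\varphi(\hat{x}^k)^{-1}\nabla\varphi(\hat{x}^k)$ if $\lambda_{\min}(\nabla^2\varphi(\hat{x}^k))\ge\zeta$, and $d^k=-\nabla\varphi(\hat{x}^k)$ otherwise. Step 3: Let $\tau_k$ be the largest $\tau\in\{\beta^i : i\in\mathbb{N}\}$ such that $\varphi(\hat{x}^k+\tau d^k)\le\varphi(\hat{x}^k)+\sigma\tau\langle\nabla\varphi(\hat{x}^k),d^k\rangle$. Step 4: Set $x^{k+1}:=\hat{x}^k+\tau_k d^k$.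
   Formalization: In (ii), the convergence of ‖d^k‖ and ‖∇φ(x̂^k)‖ to 0 is stated under the additional assumption inf_k φ(x^k) > -∞ from (i); without it the claim fails, e.g. for φ(x) = x on R with x̂^k = x^k. *)

(* Defs.v *)
From HB Require Import structures.
From mathcomp Require Import all_boot all_order all_algebra.
From mathcomp Require Import all_classical all_reals all_analysis.
Set Implicit Arguments.
Unset Strict Implicit.
Unset Printing Implicit Defensive.
Import Order.TTheory GRing.Theory Num.Theory.
Import numFieldNormedType.Exports.
Local Open Scope classical_set_scope.
Local Open Scope ring_scope.

(* Points of R^n are row vectors. The library norm `|x| on 'rV[R]_n is the
   maximum norm; it is used only through the topology it induces, and every
   norm appearing in a formula is enorm. *)
Definition dotp (R : realType) (n : nat) (u v : 'rV[R]_n) : R :=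
  \sum_(i < n) u 0 i * v 0 i.

Definition enorm (R : realType) (n : nat) (u : 'rV[R]_n) : R :=
  Num.sqrt (dotp u u).

Definition grad (R : realType) (n : nat) (phi : 'rV[R]_n -> R)
    (x : 'rV[R]_n) : 'rV[R]_n :=
  \row_(i < n) 'D_(delta_mx 0 i) phi x.

(* Row convention: v *m hess phi x is the derivative of grad phi at x along v,
   so the inverse Hessian also acts by right multiplication. *)
Definition hess (R : realType) (n : nat) (phi : 'rV[R]_n -> R)
    (x : 'rV[R]_n) : 'M[R]_n :=
  'J (grad phi) x.

Definition C2 (R : realType) (n : nat) (phi : 'rV[R]_n -> R) : Prop :=
  [/\ forall x, differentiable phi x,
      forall x, differentiable (grad phi) x
    & continuous (hess phi)].

Definition C11 (R : realType) (n : nat) (L : R) (phi : 'rV[R]_n -> R) : Prop :=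
  (forall x, differentiable phi x) /\
  (forall x y, enorm (grad phi x - grad phi y) <= L * enorm (x - y)).

(* The set of eigenvalues is finite, and nonempty when A is symmetric and
   0 < n, so that the infimum is then a minimum. *)
Definition lambda_min (R : realType) (n : nat) (A : 'M[R]_n) : R :=
  inf [set a : R | eigenvalue A a].

Definition newton_direction (R : realType) (n : nat) (phi : 'rV[R]_n -> R)
    (zeta : R) (xhat : 'rV[R]_n) : 'rV[R]_n :=
  if zeta <= lambda_min (hess phi xhat)
  then - (grad phi xhat *m invmx (hess phi xhat))
  else - grad phi xhat.

Definition armijo_set (R : realType) (n : nat) (phi : 'rV[R]_n -> R)
    (sigma beta : R) (xhat d : 'rV[R]_n) : set R :=
  [set tau | (exists i : nat, tau = beta ^+ i) /\
     phi (xhat + tau *: d) <=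
       phi xhat + sigma * tau * dotp (grad phi xhat) d].

Definition is_step_size (R : realType) (n : nat) (phi : 'rV[R]_n -> R)
    (sigma beta : R) (xhat d : 'rV[R]_n) (tau : R) : Prop :=
  armijo_set phi sigma beta xhat d tau /\
  ubound (armijo_set phi sigma beta xhat d) tau.

(* A run of the algorithm, with arbitrary admissible choices of xhat k.
   Iteration k is carried out only if no earlier iteration has stopped; it
   stops at k if grad phi (xhat k) = 0, and the values of the sequences beyond
   that point are then irrelevant and unconstrained. *)
Definition newton_run (R : realType) (n : nat) (phi : 'rV[R]_n -> R)
    (sigma beta zeta : R) (x0 : 'rV[R]_n)
    (x xhat d : nat -> 'rV[R]_n) (tau : nat -> R) : Prop :=
  x 0%N = x0 /\
  forall k : nat, (forall j : nat, (j < k)%N -> grad phi (xhat j) <> 0) ->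
    phi (xhat k) <= phi (x k) /\
    (grad phi (xhat k) <> 0 ->
       [/\ d k = newton_direction phi zeta (xhat k),
           is_step_size phi sigma beta (xhat k) (d k) (tau k)
         & x k.+1 = xhat k + tau k *: d k]).

(* Main.v *)
Require Import Defs.
From HB Require Import structures.
From mathcomp Require Import all_boot all_order all_algebra.
From mathcomp Require Import all_classical all_reals all_analysis.
From mathcomp Require Import ring lra.
Import Order.TTheory GRing.Theory Num.Theory.
Import numFieldNormedType.Exports.
Local Open Scope classical_set_scope.
Local Open Scope ring_scope.

(* C^2 smoothness makes the Hessian symmetric, so lambda_min bounds its
   quadratic form from below and both kinds of directions satisfy the descent
   condition <grad phi (xhat k), d k> <= - min(1, zeta) |d k|^2. The Armijo rule
   then gives phi (x (k+1)) <= phi (x k) - sigma min(1, zeta) tau_k |d k|^2,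
   which telescopes. Whenever tau_k < 1 the trial step tau_k / beta was rejected, and
   by the mean value theorem grad phi varies by at least a fixed multiple of
   |d k| along it. If grad phi is Lipschitz this bounds tau_k from below;
   near a nonstationary cluster point it contradicts the continuity of
   grad phi. Since tau_k |d k| -> 0, successive iterates get close near an
   isolated cluster point, and the sequence cannot leave its neighbourhood. *)

(** * Inner product and Euclidean norm, compared with the maximum norm *)

Lemma cvg_coord {R : realType} {m n : nat} {T : Type} {F : set_system T}
    {FF : Filter F} (M : T -> 'M[R]_(m, n)) (A : 'M[R]_(m, n)) i j :
  M @ F --> A -> M x i j @[x --> F] --> A i j.
Proof.
move=> MA; apply: (@cvg_comp _ _ _ M (fun B : 'M[R]_(m, n) => B i j) _ _ _ MA).
exact: coord_continuous.
Qed.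

Section Euclidean.
Context {R : realType} {n : nat}.
Implicit Types (u v w : 'rV[R]_n) (a : R).

Lemma dotpC u v : dotp u v = dotp v u.
Proof. by apply: eq_bigr => i _; rewrite mulrC. Qed.

Lemma dotpDl u v w : dotp (u + v) w = dotp u w + dotp v w.
Proof. by rewrite -big_split; apply: eq_bigr => i _; rewrite mxE mulrDl. Qed.

Lemma dotpZl a u w : dotp (a *: u) w = a * dotp u w.
Proof. by rewrite mulr_sumr; apply: eq_bigr => i _; rewrite mxE mulrA. Qed.

Lemma dotpNl u w : dotp (- u) w = - dotp u w.
Proof. by rewrite -scaleN1r dotpZl mulN1r. Qed.

Lemma dotp0l u : dotp 0 u = 0.
Proof. by rewrite -(scale0r u) dotpZl mul0r. Qed.

Lemma dotpDr u v w : dotp w (u + v) = dotp w u + dotp w v.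
Proof. by rewrite dotpC dotpDl !(dotpC _ w). Qed.

Lemma dotpZr a u w : dotp w (a *: u) = a * dotp w u.
Proof. by rewrite dotpC dotpZl dotpC. Qed.

Lemma dotpNr u w : dotp w (- u) = - dotp w u.
Proof. by rewrite dotpC dotpNl dotpC. Qed.

Lemma dotp_ge0 u : 0 <= dotp u u.
Proof. by apply: sumr_ge0 => i _; rewrite -expr2 sqr_ge0. Qed.

Lemma dotp_eq0 u : (dotp u u == 0) = (u == 0).
Proof.
apply/idP/eqP => [|->]; last by rewrite dotp0l.
rewrite psumr_eq0 => [/allP u0|i _]; last by rewrite -expr2 sqr_ge0.
apply/rowP => i; rewrite mxE; apply/eqP.
by have := u0 i (mem_index_enum i); rewrite mulf_eq0 orbb.
Qed.

Lemma dotp_gt0 u : (0 < dotp u u) = (u != 0).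
Proof. by rewrite lt_def dotp_ge0 andbT dotp_eq0. Qed.

Lemma dotp_all0 u : (forall w, dotp u w = 0) -> u = 0.
Proof. by move=> u0; apply/eqP; rewrite -dotp_eq0 u0. Qed.

Lemma enorm_ge0 u : 0 <= enorm u. Proof. exact: sqrtr_ge0. Qed.

Lemma enorm_sqr u : enorm u ^+ 2 = dotp u u.
Proof. by rewrite sqr_sqrtr// dotp_ge0. Qed.

Lemma enormZ a u : enorm (a *: u) = `|a| * enorm u.
Proof.
by rewrite /enorm dotpZl dotpZr mulrA -expr2 sqrtrM ?sqr_ge0// sqrtr_sqr.
Qed.

Lemma enormN u : enorm (- u) = enorm u.
Proof. by rewrite -scaleN1r enormZ normrN1 mul1r. Qed.

Lemma dotp_le u v : dotp u v <= enorm u * enorm v.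
Proof.
have [/eqP v0|v0] := eqVneq v 0.
  by rewrite (eqP v0) dotpC dotp0l mulr_ge0 ?enorm_ge0.
have vv0 : 0 < dotp v v by rewrite dotp_gt0.
(* This vector has squared norm |v|^2 (|u|^2 |v|^2 - <u,v>^2); dividing by |v|^2 > 0 gives the
   Cauchy-Schwarz inequality. *)
have := dotp_ge0 (dotp v v *: u - dotp u v *: v).
rewrite !(dotpDl, dotpDr, dotpNl, dotpNr, dotpZl, dotpZr) (dotpC v u) => h.
have h2 : 0 <= dotp v v * (dotp u u * dotp v v - dotp u v ^+ 2).
  by apply: (le_trans h); rewrite le_eqVlt; apply/orP; left; apply/eqP; ring.
apply: (le_trans (ler_norm _)); rewrite -sqrtr_sqr -sqrtrM ?dotp_ge0//.
by rewrite ler_wsqrtr// -subr_ge0; rewrite pmulr_rge0 in h2.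
Qed.

Lemma coord_le_mx_norm u i : `|u 0 i| <= `|u|.
Proof.
by rewrite [leRHS]/Num.Def.normr/= mx_normrE; exact: (le_bigmax _ _ (0, i)).
Qed.

Lemma mx_norm_le_enorm u : `|u| <= enorm u.
Proof.
rewrite [leLHS]/Num.Def.normr/= mx_normrE bigmax_le ?enorm_ge0// => -[i j] _ /=.
rewrite (ord1 i) -sqrtr_sqr ler_wsqrtr// /dotp (bigD1 j)//= expr2 lerDl.
by apply: sumr_ge0 => k _; rewrite -expr2 sqr_ge0.
Qed.

Lemma enorm_le_mx_norm u : enorm u <= Num.sqrt n%:R * `|u|.
Proof.
rewrite -(normr_id u) -sqrtr_sqr -sqrtrM ?ler0n// ler_wsqrtr//.
rewrite -[n in n%:R]card_ord -sumr_const mulr_suml; apply: ler_sum => i _.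
by rewrite mul1r -expr2 -real_normK ?num_real// lerXn2r ?nnegrE// coord_le_mx_norm.
Qed.

Lemma mx_norm_mulmx_le u (A : 'M[R]_n) : `|u *m A| <= n%:R * `|A| * `|u|.
Proof.
rewrite [leLHS]/Num.Def.normr/= mx_normrE bigmax_le ?mulr_ge0// => -[i j] _ /=.
rewrite (ord1 i) mxE (le_trans (ler_norm_sum _ _ _))//.
rewrite -[n in n%:R]card_ord -mulrA -sumr_const mulr_suml; apply: ler_sum => k _.
rewrite mul1r normrM mulrC ler_pM// ?coord_le_mx_norm//.
by rewrite [leRHS]/Num.Def.normr/= mx_normrE; exact: (le_bigmax _ _ (k, j)).
Qed.

(** Joint continuity in vectors and matrix: a constant matrix serves the Rayleigh quotient, constant
    vectors serve the Hessian form. *)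
Lemma cvg_dotp_mulmx {T : Type} {F : set_system T} {FF : Filter F}
    (f g : T -> 'rV[R]_n) (M : T -> 'M[R]_n) u v (A : 'M[R]_n) :
  f @ F --> u -> M @ F --> A -> g @ F --> v ->
  dotp (f x *m M x) (g x) @[x --> F] --> dotp (u *m A) v.
Proof.
move=> fu MA gv; apply: cvg_big => [|i _]; first exact: add_continuous.
apply: cvgM; last exact: cvg_coord.
rewrite mxE; under eq_fun do rewrite mxE.
apply: cvg_big => [|k _]; first exact: add_continuous.
by apply: cvgM; exact: cvg_coord.
Qed.

Lemma cvg_dotp {T : Type} {F : set_system T} {FF : Filter F}
    (f g : T -> 'rV[R]_n) u v :
  f @ F --> u -> g @ F --> v -> dotp (f x) (g x) @[x --> F] --> dotp u v.
Proof.
move=> fu gv; rewrite -(mulmx1 u); under eq_fun do rewrite -(mulmx1 (f _)).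
by apply: cvg_dotp_mulmx => //; exact: cvg_cst.
Qed.

Lemma cvg_enorm {T : Type} {F : set_system T} {FF : Filter F}
    (f : T -> 'rV[R]_n) u :
  f @ F --> u -> enorm (f x) @[x --> F] --> enorm u.
Proof.
move=> fu; apply: (@cvg_comp _ _ _ (fun x => dotp (f x) (f x)) Num.sqrt).
  by apply: cvg_dotp; exact: fu.
exact: sqrt_continuous.
Qed.

Lemma cvg_enorm0 {T : Type} {F : set_system T} {FF : Filter F}
    (f : T -> 'rV[R]_n) :
  enorm (f x) @[x --> F] --> 0 -> f @ F --> (0 : 'rV[R]_n).
Proof.
move=> f0; apply: norm_cvg0; apply: squeeze_cvgr (cvg_cst 0) f0.
by apply: nearW => x; rewrite normr_ge0 mx_norm_le_enorm.
Qed.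

End Euclidean.

(** * The smallest eigenvalue of a symmetric matrix *)

Section Rayleigh.
Context {R : realType} {n : nat}.
Variable A : 'M[R]_n.
Hypothesis symA : forall u v : 'rV[R]_n, dotp (u *m A) v = dotp (v *m A) u.

(* A minimiser v of the Rayleigh quotient, with minimum m, is an eigenvector:
   the quadratic form of A - m is nonnegative and vanishes at v, so its first
   variation at v vanishes. *)
Lemma rayleigh_min : n != 0%N ->
  exists2 m, eigenvalue A m & forall u, m * dotp u u <= dotp (u *m A) u.
Proof.
move=> n0.
pose S := [set u : 'rV[R]_n | dotp u u = 1].
have normS u : S u -> enorm u = 1 by rewrite /S/= /enorm => ->; rewrite sqrtr1.
have scaleS u : u != 0 -> S ((enorm u)^-1 *: u).
  move=> u0; rewrite /S/= dotpZl dotpZr -enorm_sqr mulrA -expr2 exprVn mulVf//.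
  by rewrite enorm_sqr dotp_eq0.
have S0 : S !=set0.
  case: n n0 S normS scaleS => // k _ S _ scaleS.
  exists ((enorm (const_mx 1 : 'rV[R]_k.+1))^-1 *: const_mx 1).
  apply: scaleS; apply/eqP => /rowP/(_ ord0); rewrite !mxE => /eqP.
  by rewrite oner_eq0.
have dc : continuous (fun u : 'rV[R]_n => dotp u u).
  by move=> u; exact: (cvg_dotp id id u u (fun=> id) (fun=> id)).
have cS : compact S.
  apply: bounded_closed_compact.
    exists 1; split=> // M M1 u /normS u1.
    by apply: le_trans (mx_norm_le_enorm u) _; rewrite u1 ltW.
  have := @preimage_closed _ _ (fun u : 'rV[R]_n => dotp u u) _ (fun u _ => dc u)
    (@closed_eq R 1).
  by apply.
have qc : continuous (fun u : 'rV[R]_n => dotp (u *m A) u).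
  move=> u.
  exact: (cvg_dotp_mulmx id id (cst A) u u A (fun=> id) (cvg_cst _) (fun=> id)).
have [v vS vmin] := EVT_min_rV S0 cS (continuous_subspaceT qc).
set m := dotp (v *m A) v in vmin.
have le_m u : m * dotp u u <= dotp (u *m A) u.
  have [->|u0] := eqVneq u 0.
    by rewrite mul0mx !dotp0l mulr0.
  have := vmin _ (mem_set (scaleS u u0)).
  rewrite -scalemxAl dotpZl dotpZr mulrA -expr2 exprVn enorm_sqr.
  by rewrite ler_pdivlMl ?dotp_gt0// mulrC.
exists m => //; apply/eigenvalueP; exists v; last first.
  rewrite -dotp_gt0; move: vS; rewrite inE /S/= => ->; exact: ltr01.
have vv : dotp v v = 1 by move: vS; rewrite inE.
apply/eqP; rewrite -subr_eq0; apply/eqP; apply: dotp_all0 => w.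
set c := dotp _ w.
(* This is the quadratic form of A - m at v + t w; it vanishes at v, and c is its polar form at the
   pair v, w. *)
have key t : 0 <= 2 * t * c + t ^+ 2 * (dotp (w *m A) w - m * dotp w w).
  have := le_m (v + t *: w).
  rewrite mulmxDl -scalemxAl !(dotpDl, dotpDr, dotpZl, dotpZr) vv -/m.
  rewrite (symA w v) (dotpC w v) -subr_ge0 => h.
  apply: (le_trans h); rewrite le_eqVlt; apply/orP; left; apply/eqP.
  rewrite /c dotpDl dotpNl dotpZl; ring.
set q := _ - _ in key.
have q0 : 0 <= q by rewrite subr_ge0.
(* This t turns the expression into -c^2 times a positive factor; dividing by q + 1 rather than q
   covers q = 0. *)
have := key (- c / (q + 1)).
have -> : 2 * (- c / (q + 1)) * c + (- c / (q + 1)) ^+ 2 * q =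
   - c ^+ 2 * ((q + 2) / (q + 1) ^+ 2).
  by field; rewrite gt_eqF// ltr_wpDl.
rewrite mulNr oppr_ge0 pmulr_lle0; last first.
  by rewrite divr_gt0 ?exprn_gt0// ltr_wpDl.
by move=> c2; apply/eqP; rewrite -sqrf_eq0 eq_le c2 sqr_ge0.
Qed.

(** The minimum m of the Rayleigh quotient is an eigenvalue and bounds all eigenvalues from below,
    so the infimum is at most m. *)
Lemma le_lambda_min z (u : 'rV[R]_n) :
  n != 0%N -> z <= lambda_min A -> z * dotp u u <= dotp (u *m A) u.
Proof.
move=> /rayleigh_min[m mA le_m] zA; apply: le_trans (le_m u).
rewrite ler_wpM2r ?dotp_ge0// (le_trans zA)//; apply: ge_inf => //.
exists m => a /eigenvalueP[w wA w0].
have := le_m w; rewrite wA dotpZl ler_pM2r//; by rewrite dotp_gt0.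
Qed.

End Rayleigh.

(** * Differential calculus along lines *)

Section Calculus.
Context {R : realType} {n : nat}.
Implicit Types (f phi : 'rV[R]_n -> R) (x u v : 'rV[R]_n).

(** The difference quotient of t |-> f (x + t v) at s is that of f at x + s v along v. *)
Lemma is_derive_line f x v (s : R) : differentiable f (x + s *: v) ->
  is_derive s 1 (fun t : R => f (x + t *: v)) ('D_v f (x + s *: v)).
Proof.
move=> /(@diff_derivable _ _ _ _ _ v) df.
have E : (fun h : R => h^-1 *: (((fun t : R => f (x + t *: v)) \o shift s) (h *: 1)
    - f (x + s *: v))) =
   (fun h : R => h^-1 *: ((f \o shift (x + s *: v)) (h *: v) - f (x + s *: v))).
  apply/funext => h /=; congr (_ *: (f _ - _)).
  by rewrite -[h%:A]/(h * 1) mulr1 scalerDl addrCA.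
by split; rewrite /derivable/derive E.
Qed.

Lemma mean_value_line f x v (t : R) : (forall y, differentiable f y) -> 0 < t ->
  exists2 s, 0 < s < t & f (x + t *: v) - f x = t * 'D_v f (x + s *: v).
Proof.
move=> df t0; have dl s := is_derive_line f x v s (df _).
have [|s] := @MVT R _ _ 0 t t0 (fun s _ => dl s).
  apply: continuous_subspaceT => s; apply: differentiable_continuous.
  by apply/derivable1_diffP; exact: (@ex_derive _ _ _ _ _ _ _ (dl s)).
by rewrite in_itv/= scale0r addr0 subr0 mulrC; exists s.
Qed.

Lemma derive_grad phi x v :
  differentiable phi x -> 'D_v phi x = dotp (grad phi x) v.
Proof.
move=> dphi; rewrite deriveE// {1}(row_sum_delta v) linear_sum; apply: eq_bigr => i _.
by rewrite linearZ mxE deriveE//= mulrC.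
Qed.

Lemma differentiable_dotp_grad phi u x : differentiable (grad phi) x ->
  differentiable (fun y => dotp (grad phi y) u) x.
Proof.
move=> dg; rewrite /dotp.
have -> : (fun y => \sum_(i < n) grad phi y 0 i * u 0 i) =
    \sum_(i < n) (fun y => grad phi y 0 i * u 0 i).
  by apply/funext => y; rewrite fct_sumE.
apply: differentiable_sum => i; apply: differentiableM => //.
apply: (@differentiable_comp _ _ _ _ (grad phi) (fun M : 'rV[R]_n => M 0 i)) => //.
exact: differentiable_coord.
Qed.

Lemma derive_dotp_grad phi u v x : differentiable (grad phi) x ->
  'D_v (fun y => dotp (grad phi y) u) x = dotp (v *m hess phi x) u.
Proof.
move=> dg; rewrite -deriveEjacobian//.
have dgv := @diff_derivable _ _ _ _ _ v dg.
rewrite derive_mx// /dotp.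
have -> : (fun y => \sum_(i < n) grad phi y 0 i * u 0 i) =
    \sum_(i < n) (fun y => grad phi y 0 i * u 0 i).
  by apply/funext => y; rewrite fct_sumE.
have dc i : derivable (fun y => grad phi y 0 i) x v by move/derivable_mxP: dgv.
rewrite derive_sum => [|i]; last exact: derivableM.
by apply: eq_bigr => i _; rewrite deriveMr// mxE mulrC.
Qed.

(** Mean value theorem twice: for y |-> phi (y + t v) - phi y along u, then for <grad phi, u> along
    v. *)
Lemma second_difference phi x u v (t : R) : 0 < t ->
  (forall y, differentiable phi y) -> (forall y, differentiable (grad phi) y) ->
  exists s r, [/\ 0 < s < t, 0 < r < t &
    phi (x + t *: u + t *: v) - phi (x + t *: u) - (phi (x + t *: v) - phi x) =
    t ^+ 2 * dotp (v *m hess phi (x + s *: u + r *: v)) u].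
Proof.
move=> t0 dphi dg.
have dsh y : differentiable (fun z => phi (z + t *: v)) y.
  by apply: (@differentiable_comp _ _ _ _ (fun z => z + t *: v) phi).
have Dsh y : 'D_u (fun z => phi (z + t *: v)) y = 'D_u phi (y + t *: v).
  rewrite /derive; do 2 f_equal; apply/funext => h /=.
  by rewrite addrA.
have [s st E1] := @mean_value_line (fun y => phi (y + t *: v) - phi y) x u t
   (fun y => differentiableB (dsh y) (dphi y)) t0.
have [r rt E2] := mean_value_line (fun y => dotp (grad phi y) u) (x + s *: u) v t
   (fun y => differentiable_dotp_grad phi u y (dg y)) t0.
exists s, r; split => //; rewrite E1 deriveB ?Dsh; try exact: diff_derivable.
by rewrite !derive_grad// E2 derive_dotp_grad// expr2 mulrA.
Qed.

(* Schwarz's theorem: the second difference of phi in the directions u and v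
   is symmetric in u and v. *)
Lemma hess_sym phi x u v : C2 phi ->
  dotp (u *m hess phi x) v = dotp (v *m hess phi x) u.
Proof.
move=> [dphi dg ch].
have cvg_hess a b : dotp (a *m hess phi y) b @[y --> x] --> dotp (a *m hess phi x) b.
  exact: (cvg_dotp_mulmx (cst a) (cst b) _ _ _ _ (cvg_cst a) (ch x) (cvg_cst b)).
apply/eqP; rewrite -subr_eq0 -normr_le0; apply/ler_addgt0Pl => e e0; rewrite addr0.
have e2 : 0 < e / 2 by rewrite divr_gt0.
have /cvgrPdist_lt/(_ _ e2) := cvg_hess u v.
have /cvgrPdist_lt/(_ _ e2) := cvg_hess v u.
near_simpl => h1 h2.
have [d /= d0 hd] := (nbhs_normP _ _).1 (filterI h1 h2).
(* Every x + s u + r v with 0 < s, r < t then lies within d of x; the 1 keeps the denominator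
   positive. *)
pose t := d / (`|u| + `|v| + 1).
have uv0 : 0 < `|u| + `|v| + 1 by rewrite ltr_wpDl// addr_ge0.
have t0 : 0 < t by rewrite divr_gt0.
have close a b (s r : R) : 0 < s < t -> 0 < r < t -> `|a| + `|b| = `|u| + `|v| ->
    ball_ Num.norm x d (x + s *: a + r *: b).
  move=> /andP[s0 st] /andP[r0 rt] ab.
  rewrite /ball_/= -addrA opprD addNKr normrN (le_lt_trans (ler_normD _ _))//.
  rewrite !normrZ !gtr0_norm// (@le_lt_trans _ _ (t * (`|u| + `|v|)))//.
    by rewrite -ab mulrDr lerD// ler_wpM2r// ltW.
  by rewrite /t mulrAC ltr_pdivrMr// ltr_pM2l// ltrDl.
have [s [r [st rt E1]]] := second_difference phi x u v t t0 dphi dg.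
have [s' [r' [st' rt' E2]]] := second_difference phi x v u t t0 dphi dg.
have [l1 _] := hd _ (close u v s r st rt erefl).
have [_ l2] := hd _ (close v u s' r' st' rt' (addrC _ _)).
move: E1 E2 l1 l2 => /=; set p := _ + s *: u + _; set q := _ + s' *: v + _.
move=> E1 E2 l1 l2.
(* Both sides are the same second difference of phi divided by t^2. *)
have E : dotp (v *m hess phi p) u = dotp (u *m hess phi q) v.
  apply: (@mulfI _ (t ^+ 2)); first by rewrite gt_eqF// exprn_gt0.
  rewrite -E1 -E2 (addrAC x).
  move: (phi _) (phi (x + t *: u)) (phi (x + t *: v)) (phi x) => a b c k.
  by ring.
have aux (a b c k : R) : c = k -> `|a - c| < e / 2 -> `|b - k| < e / 2 ->
    `|b - a| <= e.
  move=> -> l3 l4; rewrite -(subrKA k) (splitr e) (le_trans (ler_normD _ _))//.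
  by rewrite lerD ?ltW// distrC.
exact: aux E l1 l2.
Qed.

End Calculus.

(** * Search directions and step sizes *)

Section Step.
Context {R : realType} {n : nat}.
Variables (phi : 'rV[R]_n -> R) (sigma beta zeta : R).
Hypotheses (phiC2 : C2 phi) (sigma_gt0 : 0 < sigma) (sigma_lt1 : sigma < 1)
  (beta_gt0 : 0 < beta) (beta_lt1 : beta < 1) (zeta_gt0 : 0 < zeta).
Implicit Types (x d : 'rV[R]_n).

Let dphi : forall x, differentiable phi x. Proof. by case: phiC2. Qed.

(** In dimension 0 every vector is 0; positive dimension is what the eigenvalue bound requires. *)
Lemma grad_neq0_dim x : grad phi x <> 0 -> n != 0%N.
Proof.
move=> g0; apply/negP => /eqP n0; apply: g0; apply/rowP => i.
by have := ltn_ord i; rewrite [X in (_ < X)%N]n0.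
Qed.

(** A row vector v in the kernel of the Hessian H satisfies zeta |v|^2 <= <v H, v> = 0. *)
Lemma hess_unit x : n != 0%N ->
  zeta <= lambda_min (hess phi x) -> hess phi x \in unitmx.
Proof.
move=> n0 zl; rewrite -row_free_unit; apply: inj_row_free => v vH.
have := le_lambda_min _ (fun u v => hess_sym phi x u v phiC2) zeta v n0 zl.
rewrite vH dotp0l pmulr_rle0// => vv.
by apply/eqP; rewrite -dotp_eq0 eq_le vv dotp_ge0.
Qed.

(** Expressing the gradient through d makes the quadratic form of the Hessian at d appear in <grad
    phi x, d>. *)
Lemma newton_direction_cases x : grad phi x <> 0 ->
  let d := newton_direction phi zeta x in
  (zeta <= lambda_min (hess phi x) /\ grad phi x = - (d *m hess phi x)) \/
  grad phi x = - d.
Proof.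
move=> g0 d; rewrite /d /newton_direction.
case: ifPn => [zl|_]; last by right; rewrite opprK.
left; split=> //; rewrite mulNmx mulmxKV ?opprK//.
exact: hess_unit (grad_neq0_dim x g0) zl.
Qed.

Lemma newton_direction_descent x : grad phi x <> 0 ->
  dotp (grad phi x) (newton_direction phi zeta x) <=
  - (Num.min 1 zeta *
     dotp (newton_direction phi zeta x) (newton_direction phi zeta x)).
Proof.
move=> g0; set d := newton_direction _ _ _.
have [[zl ->]|->] := newton_direction_cases x g0; rewrite dotpNl lerN2 -/d.
  apply: le_trans (le_lambda_min _ (fun u v => hess_sym phi x u v phiC2) zeta d
    (grad_neq0_dim x g0) zl).
  by rewrite ler_wpM2r ?dotp_ge0// ge_min lexx orbT.
by rewrite -[leRHS]mul1r ler_wpM2r ?dotp_ge0// ge_min lexx.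
Qed.

Lemma newton_direction_neq0 x :
  grad phi x <> 0 -> newton_direction phi zeta x != 0.
Proof.
move=> g0; apply/eqP => d0; apply: (g0).
by have [[_ ->]|->] := newton_direction_cases x g0; rewrite d0 ?mul0mx oppr0.
Qed.

Lemma min1zeta_gt0 : 0 < Num.min 1 zeta.
Proof. by rewrite lt_min ltr01. Qed.

Lemma newton_direction_slope x : grad phi x <> 0 ->
  dotp (grad phi x) (newton_direction phi zeta x) < 0.
Proof.
move=> g0; apply: le_lt_trans (newton_direction_descent x g0) _.
by rewrite oppr_lt0 mulr_gt0 ?min1zeta_gt0// dotp_gt0 newton_direction_neq0.
Qed.

(** As <grad phi x, d> < sigma <grad phi x, d>, the difference quotient along d falls below the
    Armijo slope for small steps. The least accepted exponent gives the largest step. *)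
Lemma step_size_exists x d : dotp (grad phi x) d < 0 ->
  exists tau, is_step_size phi sigma beta x d tau.
Proof.
move=> gd; pose P i := phi (x + beta ^+ i *: d) <=
  phi x + sigma * beta ^+ i * dotp (grad phi x) d.
have exP : exists i, P i.
  have slope : dotp (grad phi x) d < sigma * dotp (grad phi x) d.
    by rewrite -subr_gt0 -[X in _ - X]mul1r -mulrBl nmulr_lgt0// subr_lt0.
  have dv := @diff_derivable _ _ _ _ _ d (dphi x).
  have : (fun h => h^-1 *: ((phi \o shift x) (h *: d) - phi x)) @ 0^' -->
      dotp (grad phi x) d by rewrite -derive_grad.
  move=> /cvgr_lt/(_ _ slope)/nbhs_ballP[e /= e0 he].
  have /cvgrPdist_lt/(_ _ e0)[i _ hi] : (GRing.exp beta : nat -> R) @ \oo --> 0.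
    by apply: cvg_expr; rewrite gtr0_norm.
  have bi0 : 0 < beta ^+ i by rewrite exprn_gt0.
  exists i; rewrite /P -lerBlDl.
  have := he (beta ^+ i) (hi i (leqnn i)) (lt0r_neq0 bi0).
  rewrite /= -[_ *: _]/(_ * _) mulrC ltr_pdivrMr// (addrC _ x) => /ltW.
  by rewrite mulrAC.
case: (ex_minnP exP) => i Pi imin; exists (beta ^+ i).
split; first by split; [exists i|].
move=> _ [[j ->] /imin ij].
by rewrite ler_wiXn2l ?ltW.
Qed.

Lemma step_size_gt0 x d tau : is_step_size phi sigma beta x d tau -> 0 < tau.
Proof. by move=> [[[i ->] _] _]; rewrite exprn_gt0. Qed.

Lemma step_size_le1 x d tau : is_step_size phi sigma beta x d tau -> tau <= 1.
Proof. by move=> [[[i ->] _] _]; rewrite exprn_ile1 ?ltW. Qed.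

(* If tau < 1, then the step size tau / beta was rejected. *)
Lemma step_size_backtrack x tau : grad phi x <> 0 ->
  let d := newton_direction phi zeta x in
  is_step_size phi sigma beta x d tau ->
  tau = 1 \/ exists2 s, 0 < s < tau / beta &
    (1 - sigma) * Num.min 1 zeta * enorm d < enorm (grad phi (x + s *: d) - grad phi x).
Proof.
move=> g0 d [[[i ->] _] taumax]; case: i taumax => [|i] taumax; first by left.
right; have bi0 : 0 < beta ^+ i by rewrite exprn_gt0.
have tE : beta ^+ i.+1 / beta = beta ^+ i by rewrite exprSr mulfK// gt_eqF.
(* The step beta^i exceeds the largest accepted one, beta^(i+1). *)
have rej : phi x + sigma * beta ^+ i * dotp (grad phi x) d < phi (x + beta ^+ i *: d).
  rewrite ltNge; apply/negP => acc.
  have := taumax (beta ^+ i) (conj (ex_intro _ i erefl) acc).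
  by rewrite exprS leNgt gtr_pMl ?beta_lt1.
rewrite tE; have [s st E] := mean_value_line phi x d _ dphi bi0.
exists s => //; move: rej; rewrite -ltrBrDl E derive_grad//.
rewrite mulrAC mulrC ltr_pM2l// => rej.
have d0 : 0 < enorm d by rewrite sqrtr_gt0 dotp_gt0 newton_direction_neq0.
(* After multiplication by |d|, Cauchy-Schwarz bounds the right side below by <grad phi (x + s d) -
   grad phi x, d>, and the descent condition bounds min(1, zeta) |d|^2 by -<grad phi x, d>. *)
rewrite -(ltr_pM2r d0) -!mulrA -expr2 enorm_sqr.
apply: lt_le_trans (dotp_le _ _); rewrite dotpDl dotpNl.
have := newton_direction_descent x g0; rewrite /= -/d.
move: rej; set a := dotp (grad phi x) d; set b := dotp (grad phi _) d => rej ka.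
apply: (@le_lt_trans _ _ ((1 - sigma) * (- a))); last by lra.
by rewrite ler_pM2l ?subr_gt0// lerNr.
Qed.

End Step.

(** * Subsequences and cluster points *)

Section Subsequence.
Implicit Types J : set nat.

Lemma infinite_set_natP J :
  infinite_set J <-> forall N, exists2 k, (N <= k)%N & J k.
Proof.
split=> [Joo N|hJ].
  apply: contrapT => noJ; apply: Joo; apply: sub_finite_set (finite_II N) => k Jk.
  by rewrite /= ltnNge; apply/negP => Nk; apply: noJ; exists k.
move=> /finite_seqP[s sJ]; have [k] := hJ (\max_(i <- s) i).+1.
rewrite sJ/= => /[swap] ks; apply/negP; rewrite -ltnNge ltnS.
exact: (leq_bigmax_seq (F := id) k ks).
Qed.

(** Subsequences are encoded as [within J \oo]; properness is what lets bounds pass to the limit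
    along J. *)
Lemma within_infinite_proper J :
  infinite_set J -> ProperFilter (within J \oo).
Proof.
move=> /infinite_set_natP hJ; apply: Build_ProperFilter_ex => P [N _ hN].
by have [k Nk Jk] := hJ N; exists k; exact: hN.
Qed.

Context {R : realType} {V : normedModType R}.
Implicit Types (u : nat -> V) (a : V).

Lemma cluster_seqP u a : cluster (u @ \oo) a <->
  forall e : R, 0 < e -> infinite_set [set k | `|a - u k| < e].
Proof.
split=> [ua e e0|ua A B [N _ hN] /nbhs_normP[e /= e0 hB]].
  apply/infinite_set_natP => N.
  have uN : (u @ \oo) (u @` [set k | (N <= k)%N]).
    by exists N => // k Nk; exists k.
  have /ua/(_ (nbhsx_ballx a e e0))[_ [[k Nk <-]]] := uN.
  by rewrite -ball_normE; exists k.
have /infinite_set_natP/(_ N)[k Nk hk] := ua e e0.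
by exists (u k); split; [exact: hN|exact: hB].
Qed.

Lemma cluster_subseq u a : cluster (u @ \oo) a ->
  exists2 J, infinite_set J & u k @[k --> within J \oo] --> a.
Proof.
move=> /cluster_seqP ua.
have inv0 j : 0 < j.+1%:R^-1 :> R by rewrite invr_gt0.
have next j N : {k | (N <= k)%N & `|a - u k| < j.+1%:R^-1}.
  have /infinite_set_natP/(_ N) := ua _ (inv0 j).
  by move=> /cid2[k Nk hk]; exists k.
(* Indices are chosen greedily: [f j.+1] lies beyond [f j], and [u (f j)] is within 1/(j+1) of a. *)
pose f := fix f j := if j is i.+1 then s2val (next i.+1 (f i).+1)
                     else s2val (next 0%N 0%N).
have fu j : `|a - u (f j)| < j.+1%:R^-1.
  by case: j => [|j] /=; case: (next _ _).
have fS j : (f j < f j.+1)%N by rewrite /=; case: (next _ _).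
have fmono : {homo f : i j / (i <= j)%N} 
  by apply: (homo_leq leqnn leq_trans) => i; exact: ltnW.
have fge j : (j <= f j)%N by elim: j => // j /leq_ltn_trans; exact.
exists (range f).
  by apply/infinite_set_natP => N; exists (f N) => //; exists N.
apply/cvgrPdist_lt => e e0.
have [j _ hj] := near_infty_natSinv_lt (PosNum e0).
exists (f j) => // k jk [i _ ik]; rewrite -ik in jk *.
apply: lt_trans (fu i) (hj _ _) => /=.
(* An index [f i] that is at least [f j] has i >= j, since f is strictly increasing. *)
rewrite leqNgt; apply/negP => ij.
by have := leq_trans (leq_trans (fS i) (fmono _ _ ij)) jk; rewrite ltnn.
Qed.

(* Eventually the indices at which u is near a are stable under successor. *)
Lemma cvg_of_stable_near u a (e : R) : 0 < e ->
  let J := [set k | `|a - u k| <= e] in infinite_set J ->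
  u k @[k --> within J \oo] --> a ->
  (u k.+1 - u k) @[k --> within J \oo] --> (0 : V) -> u @ \oo --> a.
Proof.
move=> e0 J Joo ua du; have e2 : 0 < e / 2 by rewrite divr_gt0.
have [N1 _ h1] := (cvgrPdist_lt _ _).1 ua _ e2.
have [N2 _ h2] := (cvgrPdist_lt _ _).1 du _ e2.
(* For late k in J, u k is within e/2 of a and the next increment is below e/2. *)
have step k : (maxn N1 N2 <= k)%N -> J k -> J k.+1.
  rewrite geq_max => /andP[k1 k2] Jk; rewrite /J/=.
  have := h1 k k1 Jk; have := h2 k k2 Jk; rewrite /= sub0r normrN => l2 l1.
  rewrite -(subrKA (u k)) (le_trans (ler_normD _ _))// (splitr e) lerD ?ltW//.
  by rewrite distrC.
have /infinite_set_natP/(_ (maxn N1 N2))[k0 k0N Jk0] := Joo.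
have Jall k : (k0 <= k)%N -> J k.
  elim: k => [|k IH]; first by rewrite leqn0 => /eqP <-.
  rewrite leq_eqVlt => /predU1P[<-//|]; rewrite ltnS => k0k.
  by apply: step (IH k0k); exact: leq_trans k0k.
move=> A /ua [N _ hN]; exists (maxn N k0) => // k /=.
by rewrite geq_max => /andP[Nk kk]; apply: hN => //; exact: Jall.
Qed.

End Subsequence.

(** In a compact ball where a is the only cluster point, the terms inside the ball converge to a.
    Increments vanish along them, so the sequence eventually stays in the ball. *)
Lemma isolated_cluster_cvg {R : realType} {n : nat} (u : nat -> 'rV[R]_n) a :
  isolated (cluster (u @ \oo)) a ->
  (forall J, infinite_set J -> u k @[k --> within J \oo] --> a ->
    (u k.+1 - u k) @[k --> within J \oo] --> (0 : 'rV[R]_n)) ->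
  u @ \oo --> a.
Proof.
move=> [/set_mem ua [V /nbhs_normP[e /= e0 eV] Viso]] du.
have e2 : 0 < e / 2 by rewrite divr_gt0.
pose B := [set y : 'rV[R]_n | `|a - y| <= e / 2].
pose J := [set k | `|a - u k| <= e / 2].
have cB : closed B by exact: closed_closed_ball_.
have kB : compact B.
  apply: bounded_closed_compact => //; exists (`|a| + e / 2).
  split=> [|M hM y yB]; first exact: num_real.
  apply: le_trans (ltW hM); rewrite -[y in `|y|](subKr a).
  by rewrite (le_trans (ler_normB _ _))// lerD.
have Bnbhs : nbhs a B.
  by apply: filterS (nbhsx_ballx a _ e2) => y; rewrite -ball_normE => /ltW.
have Joo : infinite_set J.
  by apply: sub_infinite_set ((cluster_seqP _ _).1 ua _ e2) => k /ltW.
have PJ := within_infinite_proper J Joo.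
have FB : (u k @[k --> within J \oo]) B by exact: withinT.
have ua' : u k @[k --> within J \oo] --> a.
  apply: (@compact_cluster_set1 _ a _ B (@norm_hausdorff _ _) kB Bnbhs _ FB).
  apply/seteqP; split=> [y uy|_ ->].
    have yB : B y.
      apply: cB => W /(uy _ _ FB) [z [zB zW]]; by exists z.
    rewrite -Viso; split.
      by apply: eV; rewrite /ball_/= (le_lt_trans yB)// ltr_pdivrMr// ltr_pMr// ltr1n.
    by apply: cvg_cluster uy; apply: cvg_within_filter.
  (* Terms near a lie in the ball automatically, so a remains a cluster point along J. *)
  move=> A W [N _ hN] aW.
  have aWB : nbhs a (W `&` B) by exact: filterI.
  have uN : (u @ \oo) (u @` [set k | (N <= k)%N]).
    by exists N => // k Nk; exists k.
  have [_ [[k Nk <-] [Wk Bk]]] := ua _ _ uN aWB.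
  by exists (u k); split=> //; exact: hN.
exact: cvg_of_stable_near e2 Joo ua' (du J Joo ua').
Qed.

(** * Nonterminating runs *)

Lemma norm_le_dist {R : realType} {V : normedModType R} (a b : V)
    (e : R) :
  `|a - b| < e -> `|b| <= `|a| + e.
Proof.
move=> /ltW abe; rewrite -lerBlDl; apply: le_trans abe.
by rewrite distrC; exact: lerB_dist.
Qed.

Lemma dist_le_add {R : realType} {V : normedModType R} (a b c : V)
    (e : R) :
  `|c - a| < e -> `|c - b| < e -> `|a - b| <= e + e.
Proof.
move=> /ltW ca /ltW cb; rewrite -(subrKA c) (le_trans (ler_normD _ _))//.
by rewrite lerD// distrC.
Qed.

(** [v *m hess phi x] is the limit of difference quotients of the gradient, each of norm at most L
    |v|. *)
Lemma C11_hess_le {R : realType} {n : nat} (phi : 'rV[R]_n -> R) (L : R) x v :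
  C11 L phi -> differentiable (grad phi) x ->
  enorm (v *m hess phi x) <= L * enorm v.
Proof.
move=> [_ lip] dg; have dv := @diff_derivable _ _ _ _ _ v dg.
rewrite /hess -deriveEjacobian//.
have : (fun h : R => h^-1 *: ((grad phi \o shift x) (h *: v) - grad phi x)) @ 0^' -->
  'D_v (grad phi) x by exact: dv.
move=> /cvg_enorm cv; apply: cvgr_to_le cv _.
near=> h; have h0 : h != 0 by near: h; exact: nbhs_dnbhs_neq.
rewrite enormZ normfV ler_pdivrMl ?normr_gt0// (le_trans (lip _ _))//=.
by rewrite addrK enormZ mulrCA.
Unshelve. all: by end_near. Qed.

Section Run.
Context {R : realType} {n : nat}.
Variables (phi : 'rV[R]_n -> R) (sigma beta zeta : R) (x0 : 'rV[R]_n).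
Hypotheses (phiC2 : C2 phi) (sigma_gt0 : 0 < sigma) (sigma_lt1 : sigma < 1)
  (beta_gt0 : 0 < beta) (beta_lt1 : beta < 1) (zeta_gt0 : 0 < zeta).
Variables (x xhat d : nat -> 'rV[R]_n) (tau : nat -> R).
Hypotheses (run : newton_run phi sigma beta zeta x0 x xhat d tau)
  (nonstop : forall k, grad phi (xhat k) <> 0).

Let kappa := Num.min 1 zeta.

Let kappa_gt0 : 0 < kappa. Proof. exact: min1zeta_gt0. Qed.

Let xhat_le k : phi (xhat k) <= phi (x k).
Proof. by have [_ /(_ k (fun j _ => nonstop j))[]] := run. Qed.

Let dE k : d k = newton_direction phi zeta (xhat k).
Proof. by have [_ /(_ k (fun j _ => nonstop j))[_ /(_ (nonstop k))[]]] := run. Qed.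

Let tauP k : is_step_size phi sigma beta (xhat k) (d k) (tau k).
Proof. by have [_ /(_ k (fun j _ => nonstop j))[_ /(_ (nonstop k))[]]] := run. Qed.

Let xS k : x k.+1 = xhat k + tau k *: d k.
Proof. by have [_ /(_ k (fun j _ => nonstop j))[_ /(_ (nonstop k))[]]] := run. Qed.

Let tau_gt0 k : 0 < tau k. Proof. exact: step_size_gt0 (tauP k). Qed.

Let tau_le1 k : tau k <= 1. Proof. exact: step_size_le1 (tauP k). Qed.

Let enorm_d_gt0 k : 0 < enorm (d k).
Proof. by rewrite dE sqrtr_gt0 dotp_gt0 newton_direction_neq0. Qed.

(** * Sufficient decrease, monotonicity and summability *)

Lemma run_decrease k :
  phi (x k.+1) <= phi (xhat k) - sigma * kappa * (tau k * enorm (d k) ^+ 2).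
Proof.
rewrite xS; have [[_ /le_trans + _]] := tauP k; apply.
have D := newton_direction_descent phi zeta phiC2 zeta_gt0 _ (nonstop k).
rewrite -dE -/kappa in D; rewrite lerD2l enorm_sqr.
apply: le_trans (ler_wpM2l (ltW (mulr_gt0 sigma_gt0 (tau_gt0 k))) D) _.
by rewrite mulrN lerN2 mulrACA.
Qed.

Let rate_gt0 k : 0 < sigma * kappa * (tau k * enorm (d k) ^+ 2).
Proof. by rewrite !mulr_gt0// exprn_gt0. Qed.

Lemma run_lt_xhat k : phi (x k.+1) < phi (xhat k).
Proof. by rewrite (le_lt_trans (run_decrease k))// ltrBlDr ltrDl. Qed.

Lemma run_x_decreasing : decreasing_seq (fun k => phi (x k)).
Proof.
by apply/decreasing_seqP => k; exact: lt_le_trans (run_lt_xhat k) (xhat_le k).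
Qed.

Lemma run_xhat_decreasing : decreasing_seq (fun k => phi (xhat k)).
Proof.
by apply/decreasing_seqP => k; exact: le_lt_trans (xhat_le k.+1) (run_lt_xhat k).
Qed.

Let rate_le k :
  sigma * kappa * (tau k * enorm (d k) ^+ 2) <= phi (x k) - phi (x k.+1).
Proof. by have := run_decrease k; have := xhat_le k; lra. Qed.

Lemma run_sum_lt_pinfty (m : R) : (forall k, m <= phi (x k)) ->
  (\sum_(1 <= k <oo) (tau k * enorm (d k) ^+ 2)%:E < +oo)%E.
Proof.
move=> lb; have sk0 : 0 < sigma * kappa by rewrite mulr_gt0.
(* The sum starts at 1, so the decreases telescope from phi (x 1). *)
apply: (@le_lt_trans _ _ ((phi (x 1%N) - m) / (sigma * kappa))%:E); last exact: ltry.
apply: lime_le.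
  apply: is_cvg_nneseries => k _ _; rewrite lee_fin mulr_ge0// ?sqr_ge0//.
  exact: ltW.
exists 1%N => // N /= N1; rewrite sumEFin lee_fin ler_pdivlMr// mulrC mulr_sumr.
apply: (@le_trans _ _ (\sum_(1 <= k < N) (phi (x k) - phi (x k.+1)))).
  by apply: ler_sum => k _; exact: rate_le.
have -> : \sum_(1 <= k < N) (phi (x k) - phi (x k.+1)) = phi (x 1%N) - phi (x N).
  rewrite -[RHS]opprB -(telescope_sumr (fun k => phi (x k)) N1) -sumrN.
  by apply: eq_bigr => k _; rewrite opprB.
by rewrite lerD2l lerN2.
Qed.

(** The values phi (x k) are monotone and bounded below, hence convergent, so their decrements
    vanish; these dominate the quantity up to the factor sigma kappa. *)
Lemma run_rate_cvg0 (m : R) : (forall k, m <= phi (x k)) ->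
  tau k * enorm (d k) ^+ 2 @[k --> \oo] --> 0.
Proof.
move=> lb; have sk0 : 0 < sigma * kappa by rewrite mulr_gt0.
have cx : cvgn (fun k => phi (x k)).
  apply: nonincreasing_is_cvgn; first by move=> i j ij; rewrite run_x_decreasing.
  by exists m => _ [k _ <-].
have d0 : (sigma * kappa)^-1 * (phi (x k) - phi (x k.+1)) @[k --> \oo] --> 0.
  rewrite -(mulr0 (sigma * kappa)^-1) -(subrr (limn (fun k => phi (x k)))).
  apply: cvgM; first exact: cvg_cst.
  apply: cvgB; first exact: cx.
  by have := cx; rewrite -(cvg_shiftS (fun k => phi (x k))).
apply: squeeze_cvgr (cvg_cst 0) d0; apply: nearW => k.
apply/andP; split; first by rewrite mulr_ge0 ?sqr_ge0// ltW.
by rewrite ler_pdivlMl//; exact: rate_le.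
Qed.

(** Extracts a real bound: the infimum cannot be +oo because it is at most phi (x 0). *)
Lemma run_lbound :
  (-oo < ereal_inf (range (fun k : nat => (phi (x k))%:E)))%E ->
  exists m : R, forall k, m <= phi (x k).
Proof.
have lb k : (ereal_inf (range (fun k : nat => (phi (x k))%:E)) <= (phi (x k))%:E)%E.
  by apply: ereal_inf_lbound; exists k.
case: (ereal_inf _) lb => [r|/(_ 0%N)|]//= lb _; exists r => k.
by have := lb k; rewrite lee_fin.
Qed.

(** Since tau_k <= 1, |tau_k d_k|^2 <= tau_k |d_k|^2. *)
Lemma run_step_cvg0 (m : R) : (forall k, m <= phi (x k)) ->
  (tau k *: d k) @[k --> \oo] --> (0 : 'rV[R]_n).
Proof.
move=> lb; apply: cvg_enorm0.
have h : Num.sqrt (tau k * enorm (d k) ^+ 2) @[k --> \oo] --> Num.sqrt (0 : R).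
  apply: (@cvg_comp _ _ _ (fun k => tau k * enorm (d k) ^+ 2) Num.sqrt).
    exact: run_rate_cvg0 lb.
  exact: sqrt_continuous.
rewrite sqrtr0 in h; apply: squeeze_cvgr (cvg_cst 0) h; apply: nearW => k.
rewrite enorm_ge0 enormZ gtr0_norm//=.
have -> : tau k * enorm (d k) = Num.sqrt ((tau k * enorm (d k)) ^+ 2).
  by rewrite sqrtr_sqr gtr0_norm// mulr_gt0.
by rewrite ler_wsqrtr// exprMn ler_wpM2r ?sqr_ge0// expr2 ler_piMl// ltW.
Qed.


(** * Step sizes, directions and gradients under a Lipschitz gradient *)

Lemma run_tau_lbound L : 0 < L -> C11 L phi ->
  exists2 c, 0 < c & forall k, c <= tau k.
Proof.
(* If tau_k < 1, the rejected step gives (1 - sigma) kappa |d_k| < L s |d_k| with s < tau_k / beta;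
   the 1 covers tau_k = 1. *)
move=> L0 [_ lip]; exists (Num.min 1 (beta * ((1 - sigma) * kappa) / L)).
  by rewrite lt_min ltr01 divr_gt0// !mulr_gt0// subr_gt0.
move=> k; have tk := tauP k; rewrite dE in tk.
have [->|[s /andP[s0 st]]] := step_size_backtrack phi sigma beta zeta
    phiC2 sigma_lt1 beta_gt0 beta_lt1 zeta_gt0 _ _ (nonstop k) tk.
  by rewrite ge_min lexx.
rewrite -dE -/kappa => /lt_le_trans/(_ (lip _ _)).
rewrite addrAC subrr add0r enormZ gtr0_norm// mulrA ltr_pM2r// => lt_s.
rewrite ge_min; apply/orP; right; rewrite ler_pdivrMr// mulrC -ler_pdivlMr//.
rewrite mulrAC (le_trans (ltW lt_s))// mulrC ler_pM2r//; exact: ltW.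
Qed.

Lemma run_d_cvg0 (m c : R) : (forall k, m <= phi (x k)) ->
  0 < c -> (forall k, c <= tau k) -> enorm (d k) @[k --> \oo] --> 0.
Proof.
move=> lb c0 c_le.
have h : c^-1 * enorm (tau k *: d k) @[k --> \oo] --> c^-1 * enorm (0 : 'rV[R]_n).
  apply: cvgM; first exact: cvg_cst.
  exact: (cvg_enorm (fun k => tau k *: d k) 0 (run_step_cvg0 m lb)).
rewrite /enorm dotp0l sqrtr0 mulr0 -/(enorm _) in h.
apply: squeeze_cvgr (cvg_cst 0) h; apply: nearW => k.
rewrite enorm_ge0 -/(enorm _) enormZ gtr0_norm//= ler_pdivlMl//.
by rewrite ler_wpM2r// enorm_ge0.
Qed.

(** The gradient norm is at most L |d_k| for a Newton step and equals |d_k| for a gradient step; 1 +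
    L covers both. *)
Lemma run_grad_cvg0 L : 0 < L -> C11 L phi ->
  enorm (d k) @[k --> \oo] --> 0 ->
  enorm (grad phi (xhat k)) @[k --> \oo] --> 0.
Proof.
move=> L0 lip d0.
have h : (1 + L) * enorm (d k) @[k --> \oo] --> (1 + L) * 0.
  by apply: cvgM => //; exact: cvg_cst.
rewrite mulr0 in h; apply: squeeze_cvgr (cvg_cst 0) h; apply: nearW => k.
rewrite enorm_ge0 /= mulrDl mul1r.
have [[_ ->]|->] := newton_direction_cases phi zeta phiC2 zeta_gt0 _ (nonstop k);
    rewrite -dE enormN.
  apply: (le_trans (C11_hess_le _ _ _ _ lip _)); first by case: phiC2.
  by rewrite lerDr enorm_ge0.
by rewrite lerDl mulr_ge0 ?enorm_ge0// ltW.
Qed.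

(** Where the Hessian stays bounded, a gradient bounded away from 0 thus keeps the direction away
    from 0. *)
Lemma run_grad_le k :
  `|grad phi (xhat k)| <= (1 + n%:R * `|hess phi (xhat k)|) * `|d k|.
Proof.
rewrite mulrDl mul1r.
have [[_ {1}->]|{1}->] := newton_direction_cases phi zeta phiC2 zeta_gt0 _ (nonstop k);
    rewrite -dE normrN.
  by rewrite (le_trans (mx_norm_mulmx_le _ _))// lerDr.
by rewrite lerDl !mulr_ge0.
Qed.

(* If grad phi xbar <> 0, then along J the directions stay away from 0, so the
   steps tau k *: d k can only vanish if the step sizes are eventually < 1.
   The rejected trial points converge to xbar as well, which contradicts
   step_size_backtrack. *)
Lemma run_stationary (m : R) (J : set nat) (xbar : 'rV[R]_n) :
  (forall k, m <= phi (x k)) -> infinite_set J ->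
  xhat k @[k --> within J \oo] --> xbar -> grad phi xbar = 0.
Proof.
move=> lb Joo xbarP; have PF := within_infinite_proper J Joo.
apply: contrapT => G0.
have [_ dg ch] := phiC2.
have cg : continuous (grad phi) by move=> y; exact: differentiable_continuous.
have ga0 : 0 < `|grad phi xbar| / 2.
  by rewrite divr_gt0// normr_gt0; apply/eqP.
have gk : grad phi (xhat k) @[k --> within J \oo] --> grad phi xbar.
  by apply: (@cvg_comp _ _ _ xhat (grad phi) _ _ _ xbarP); exact: cg.
have hk : hess phi (xhat k) @[k --> within J \oo] --> hess phi xbar.
  by apply: (@cvg_comp _ _ _ xhat (hess phi) _ _ _ xbarP); exact: ch.
have stepk : (tau k *: d k) @[k --> within J \oo] --> (0 : 'rV[R]_n).
  by apply: cvg_within_filter; exact: run_step_cvg0 lb.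
(* M bounds the factor of [run_grad_le] near xbar, so c bounds |d_k| from below; q dominates the
   norm comparison constant, and e is chosen so that q (e + e) = (1 - sigma) kappa c. *)
pose M := 1 + n%:R * (`|hess phi xbar| + 1).
have M0 : 0 < M by rewrite ltr_wpDr// mulr_ge0// addr_ge0.
pose c := `|grad phi xbar| / 2 / M.
have c0 : 0 < c by rewrite divr_gt0.
pose q : R := Num.sqrt n%:R + 1.
have q0 : 0 < q by rewrite ltr_wpDl// sqrtr_ge0.
pose e := (1 - sigma) * kappa * c / (2 * q).
have e0 : 0 < e by rewrite divr_gt0 ?(mulr_gt0, subr_gt0, c0).
have [del del0 hdel] := (nbhs_normP _ _).1 ((cvgrPdist_lt _ _).1 (cg xbar) _ e0).
have del2 : 0 < del / 2 by rewrite divr_gt0.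
have bdel : 0 < beta * (del / 2) by rewrite mulr_gt0.
have : \forall k \near within J \oo, False; last by move=> /filter_ex[].
near=> k.
have k1 : `|grad phi xbar - grad phi (xhat k)| < `|grad phi xbar| / 2.
  by near: k; exact: (cvgrPdist_lt _ _).1 gk _ ga0.
have k2 : `|hess phi xbar - hess phi (xhat k)| < 1.
  by near: k; exact: (cvgrPdist_lt _ _).1 hk _ ltr01.
have k3 : `|xbar - xhat k| < del / 2.
  by near: k; exact: (cvgrPdist_lt _ _).1 xbarP _ del2.
have k4 : `|tau k *: d k| < beta * (del / 2).
  by near: k; exact: cvgr0_norm_lt stepk _ bdel.
have k5 : `|tau k *: d k| < c.
  by near: k; exact: cvgr0_norm_lt stepk _ c0.
rewrite normrZ gtr0_norm// in k4 k5.
have hM : 1 + n%:R * `|hess phi (xhat k)| <= M.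
  by rewrite /M lerD2l; apply: ler_wpM2l; [exact: ler0n|exact: norm_le_dist k2].
have cd : c <= `|d k|.
  rewrite ler_pdivrMr// [leRHS]mulrC; apply: le_trans (ler_wpM2r (normr_ge0 _) hM).
  apply: le_trans (run_grad_le k).
  rewrite -(lerD2r (`|grad phi xbar| / 2)) -splitr.
  by apply: norm_le_dist; rewrite distrC.
have tau1 : tau k <> 1 by move=> t1; move: k5; rewrite t1 mul1r ltNge cd.
have tk := tauP k; rewrite dE in tk.
have [//|[s /andP[s0 st]]] := step_size_backtrack phi sigma beta zeta
    phiC2 sigma_lt1 beta_gt0 beta_lt1 zeta_gt0 _ _ (nonstop k) tk.
rewrite -dE -/kappa; apply/negP; rewrite -leNgt.
(* From s < tau_k / beta and tau_k |d_k| < beta del / 2; the point xhat_k + s d_k thus stays within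
   del of xbar. *)
have sd : `|s *: d k| < del / 2.
  rewrite normrZ gtr0_norm// -(ltr_pM2l beta_gt0); apply: le_lt_trans k4.
  rewrite mulrA ler_wpM2r// mulrC -ler_pdivlMr//; exact: ltW.
have g1 : `|grad phi xbar - grad phi (xhat k + s *: d k)| < e.
  apply: hdel; rewrite /ball_/= opprD addrA (le_lt_trans (ler_normB _ _))//.
  by rewrite (splitr del) ltrD.
have g2 : `|grad phi xbar - grad phi (xhat k)| < e.
  apply: hdel; rewrite /ball_/= (lt_trans k3)// ltr_pdivrMr// ltr_pMr//; exact: ltr1n.
apply: (le_trans (enorm_le_mx_norm _)).
apply: (@le_trans _ _ (q * (e + e))).
  apply: ler_pM; [exact: sqrtr_ge0|exact: normr_ge0|by rewrite lerDl|].
  exact: dist_le_add g1 g2.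
have -> : q * (e + e) = (1 - sigma) * kappa * c.
  by rewrite /e; field; rewrite gt_eqF.
rewrite ler_pM2l ?mulr_gt0 ?subr_gt0//.
exact: le_trans cd (mx_norm_le_enorm _).
Unshelve. all: by end_near. Qed.

(** The values phi (x k) decrease and tend to phi xbar along a subsequence. A cluster point thus
    supplies the lower bound from which the steps are shown to vanish. *)
Lemma run_cluster_le (xbar : 'rV[R]_n) k :
  cluster (x @ \oo) xbar -> phi xbar <= phi (x k).
Proof.
move=> /cluster_subseq[J Joo xJ]; have PF := within_infinite_proper J Joo.
have [dphi _ _] := phiC2.
have cphi : continuous phi by move=> y; exact: differentiable_continuous.
have : phi (x i) @[i --> within J \oo] --> phi xbar.
  by apply: (@cvg_comp _ _ _ x phi _ _ _ xJ); exact: cphi.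
move=> /cvgr_to_le; apply; exists k => // i ki _.
by rewrite /= run_x_decreasing.
Qed.

Hypothesis xhat_near : forall J : set nat, infinite_set J ->
  cvg (x k @[k --> within J \oo]) ->
  enorm (xhat k - x k) @[k --> within J \oo] --> 0.

Let cvg_xhat_sub J (xbar : 'rV[R]_n) : infinite_set J ->
  x k @[k --> within J \oo] --> xbar ->
  (xhat k - x k) @[k --> within J \oo] --> (0 : 'rV[R]_n).
Proof.
move=> Joo xJ; apply: cvg_enorm0; apply: xhat_near => //.
by apply/cvg_ex; exists xbar.
Qed.

Lemma run_cluster_stationary xbar :
  cluster (x @ \oo) xbar -> grad phi xbar = 0.
Proof.
move=> clx; have [J Joo xJ] := cluster_subseq _ _ clx.
apply: (run_stationary (phi xbar) J) => // [k|]; first exact: run_cluster_le.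
rewrite -(add0r xbar).
have -> : xhat = (fun k => (xhat k - x k) + x k).
  by apply/funext => k; rewrite subrK.
exact: cvgD (cvg_xhat_sub J xbar Joo xJ) xJ.
Qed.

(** The increment of x splits into xhat k - x k, which vanishes along J by [xhat_near], and the
    step, which vanishes since phi xbar bounds the values below. *)
Lemma run_isolated_cvg xbar :
  isolated (cluster (x @ \oo)) xbar -> x @ \oo --> xbar.
Proof.
move=> iso; have clx := isolatedS iso.
apply: isolated_cluster_cvg => // J Joo xJ.
have -> : (fun k => x k.+1 - x k) = (fun k => (xhat k - x k) + tau k *: d k).
  by apply/funext => k; rewrite xS addrAC.
rewrite -(addr0 0); apply: cvgD; first exact: cvg_xhat_sub xJ.
apply: cvg_within_filter; apply: (run_step_cvg0 (phi xbar)) => k.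
exact: run_cluster_le.
Qed.

End Run.

(** The limits in (ii) are stated for values bounded below: for a nonzero linear phi the run with
    xhat k = x k takes the same nonzero step forever. *)
Theorem theorem2p5 (R : realType) (n : nat) (phi : 'rV[R]_n -> R)
    (sigma beta zeta : R) (x0 : 'rV[R]_n)
    (phiC2 : C2 phi)
    (sigma_gt0 : 0 < sigma) (sigma_lt : sigma < 1 / 2)
    (beta_gt0 : 0 < beta) (beta_lt1 : beta < 1)
    (zeta_gt0 : 0 < zeta) :
  (* every iteration that does not stop in Step 1 can be carried out *)
  (forall xhat : 'rV[R]_n, grad phi xhat <> 0 ->
     (zeta <= lambda_min (hess phi xhat) -> hess phi xhat \in unitmx) /\
     exists tau : R,
       is_step_size phi sigma beta xhat (newton_direction phi zeta xhat) tau)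
  /\
  (forall (x xhat d : nat -> 'rV[R]_n) (tau : nat -> R),
     newton_run phi sigma beta zeta x0 x xhat d tau ->
     (exists k : nat, grad phi (xhat k) = 0)
     \/
     [/\ decreasing_seq (fun k => phi (x k))
           /\ decreasing_seq (fun k => phi (xhat k)),
         (* (i) *)
         (-oo < ereal_inf (range (fun k : nat => (phi (x k))%:E)))%E ->
         (\sum_(1 <= k <oo) (tau k * enorm (d k) ^+ 2)%:E < +oo)%E,
         (* (ii) *)
         forall L : R, 0 < L -> C11 L phi ->
           (exists2 c : R, 0 < c & forall k : nat, c <= tau k) /\
           ((-oo < ereal_inf (range (fun k : nat => (phi (x k))%:E)))%E ->
            enorm (d k) @[k --> \oo] --> 0 /\
            enorm (grad phi (xhat k)) @[k --> \oo] --> 0)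
       & (* (iii) *)
         (forall J : set nat, infinite_set J ->
            cvg (x k @[k --> within J \oo]) ->
            enorm (xhat k - x k) @[k --> within J \oo] --> 0) ->
         (forall xbar : 'rV[R]_n, cluster (x k @[k --> \oo]) xbar ->
            grad phi xbar = 0) /\
         (forall xbar : 'rV[R]_n, isolated (cluster (x k @[k --> \oo])) xbar ->
            x k @[k --> \oo] --> xbar)]).
Proof.
have sigma_lt1 : sigma < 1 by lra.
split=> [y g0|x xhat d tau run].
  split; first exact: hess_unit phiC2 zeta_gt0 _ (grad_neq0_dim _ _ g0).
  exact: step_size_exists phiC2 sigma_lt1 beta_gt0 beta_lt1 _ _
    (newton_direction_slope phi zeta phiC2 zeta_gt0 _ g0).
have [stop|nonstop] := pselect (exists k, grad phi (xhat k) = 0); [by left|right].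
have {}nonstop k : grad phi (xhat k) <> 0 by move=> g0; apply: nonstop; exists k.
split.
- split; first exact: run_x_decreasing run nonstop.
  exact: run_xhat_decreasing run nonstop.
- move=> /run_lbound[m lb].
  exact: run_sum_lt_pinfty run nonstop m lb.
- move=> L L0 lip.
  have [c c0 c_le] := run_tau_lbound phi sigma beta zeta x0 phiC2 sigma_lt1
    beta_gt0 beta_lt1 zeta_gt0 x xhat d tau run nonstop L L0 lip.
  split; first by exists c.
  move=> /run_lbound[m lb].
  have d0 : enorm (d k) @[k --> \oo] --> 0.
    exact: run_d_cvg0 run nonstop m c lb c0 c_le.
  by split=> //; exact: run_grad_cvg0 run nonstop L L0 lip d0.
- move=> xhat_near; split=> xbar.
    exact: run_cluster_stationary run nonstop xhat_near xbar.
  exact: run_isolated_cvg run nonstop xhat_near xbar.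
Qed.
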